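(* Let $t,\,k,\,v$ be integers with $k\ge t\ge 2$ and $v\ge 2$, and let $\eta=\binom{k}{t}$ and $\rho=\binom{k}{t}-\binom{k-t}{t}$. If \[ \frac{\eta\, v^t \log\left(\frac{v^{t}}{v^{t}-1}\right)}{\rho}\le v^t, \] then \[ \mathsf{CAN}(t,k,v)\le \frac{\log\binom{k}{t}+t\log v+\log\log\left(\frac{v^{t}}{v^{t}-1}\right)+2}{\log\left(\frac{v^{t}}{v^{t}-1}\right)}-\frac{\eta}{\rho}. \]
   Context: Here $\log$ denotes the natural logarithm, and $\binom{a}{b}=0$ when $a<b$. Let $N,t,k,v$ be integers with $k\ge t\ge 2$, $v\ge 2$. A covering array $\mathsf{CA}(N;t,k,v)$ is an $N\times k$ array $A$ with entries from a $v$-element alphabet $\Sigma$ such that for every choice of $t$ distinct columns $c_1,\dots,c_t$ and every $t$-tuple $(a_1,\dots,a_t)\in\Sigma^t$, there is a row $r$ of $A$ with $A(r,c_i)=a_i$ for all $1\le i\le t$. $\mathsf{CAN}(t,k,v)$ denotes the smallest $N$ for which a $\mathsf{CA}(N;t,k,v)$ exists. *)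

(* Defs.v *)
From mathcomp Require Import all_boot all_algebra.

Set Implicit Arguments.
Unset Strict Implicit.
Unset Printing Implicit Defensive.

(* The alphabet is 'I_v; a choice of t distinct columns is an injective map c
   from 'I_t to 'I_k. *)
Definition is_CA (N t k v : nat) (A : 'M['I_v]_(N, k)) : bool :=
  [forall c : {ffun 'I_t -> 'I_k}, injectiveb c ==>
    [forall a : {ffun 'I_t -> 'I_v},
      [exists r : 'I_N, [forall i : 'I_t, A r (c i) == a i]]]].

Definition has_CA (t k v N : nat) : bool :=
  [exists A : 'M['I_v]_(N, k), is_CA t A].

Lemma has_CA_full (t k v : nat) : 0 < v ->
  has_CA t k v #|{ffun 'I_k -> 'I_v}|.
Proof.
move=> v_gt0; apply/existsP.
exists (\matrix_(r, j) (enum_val r : {ffun 'I_k -> 'I_v}) j)%R.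
apply/forallP => c; apply/implyP => /injectiveP c_inj.
apply/forallP => a; apply/existsP.
pose f : {ffun 'I_k -> 'I_v} :=
  [ffun j => if [pick i | c i == j] is Some i then a i else Ordinal v_gt0].
exists (enum_rank f); apply/forallP => i.
rewrite mxE enum_rankK ffunE; case: pickP => [i' /eqP/c_inj -> //|].
by move/(_ i); rewrite eqxx.
Qed.

Lemma exists_CA (t k v : nat) : exists N, (v == 0) || has_CA t k v N.
Proof.
by case: v => [|v]; [exists 0 | eexists; exact: has_CA_full].
Qed.

(* The disjunct v == 0 only makes the function total: on an empty alphabet a
   covering array need not exist, and CAN t k 0 is 0. For 0 < v, see CANP. *)
Definition CAN (t k v : nat) : nat := ex_minn (exists_CA t k v).

Lemma CANP (t k v : nat) : 0 < v ->
  has_CA t k v (CAN t k v) /\ (forall N, has_CA t k v N -> CAN t k v <= N).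
Proof.
rewrite /CAN lt0n => v_neq0; case: ex_minnP => N.
by rewrite (negbTE v_neq0) /= => hN minN; split.
Qed.

(* Main.v *)
Require Import Defs.
From mathcomp Require Import all_boot all_order all_algebra.
From mathcomp Require Import zify ring lra.

(** Write V = v^t, L = log (V / (V - 1)) and x = log (eta V L) / L. The
    hypothesis says exactly that eta / rho <= 1 / L, so for k > t it suffices
    to have CAN <= x + 1 / L. In the classical two-stage argument, n random
    (or greedy) rows leave at most eta V e^(-nL) interactions uncovered, each of
    which is then covered by a row of its own; the total is x + 1 / L at the
    real minimiser n = x, but rounding n up loses about L / 2. Starting from two
    rows that disagree everywhere multiplies the number of uncovered
    interactions by 1 - 1 / (V - 1)^2, which recovers that loss. For k = t all
    V words form a covering array, and V <= 2 (V - 1) - 1. *)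

Definition covers {t k v : nat} (f : {ffun 'I_k -> 'I_v})
    (x : t.-tuple 'I_k * {ffun 'I_t -> 'I_v}) : bool :=
  [forall i, f (tnth x.1 i) == x.2 i].

(** Column sets are encoded as increasing tuples, so that each of the ['C(k, t)] sets is counted
    once; [is_CA] ranges over injective maps instead. *)
Definition interactions (t k v : nat) :
    {set t.-tuple 'I_k * {ffun 'I_t -> 'I_v}} :=
  setX [set c | sorted ltn (map val (val c))] setT.

Definition uncovered {t k v : nat} (rs : seq {ffun 'I_k -> 'I_v}) :
    {set t.-tuple 'I_k * {ffun 'I_t -> 'I_v}} :=
  [set x in interactions t k v | ~~ has (covers^~ x) rs].

Lemma interactions_uniq {t k v : nat} x :
  x \in interactions t k v -> uniq x.1.
Proof.
case: x => c a; rewrite !inE andbT /= => /(sorted_uniq ltn_trans ltnn).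
by rewrite (map_inj_uniq val_inj).
Qed.

(** The rows covering an interaction form a product set: one letter is allowed in each of its [t]
    columns, all [v] letters elsewhere. *)
Lemma card_covers {t k v : nat} x : x \in interactions t k v ->
  #|[set f | covers f x]| * v ^ t = v ^ k.
Proof.
move=> /interactions_uniq; case: x => c a /= uc.
pose F j := [pred b | [forall i, (tnth c i == j) ==> (a i == b)]].
have -> : #|[set f | covers f (c, a)]| = #|family F|.
  apply: eq_card => f; rewrite inE; apply/forallP/familyP => [fc j | fF i].
    by apply/forallP => i; apply/implyP => /eqP <-; rewrite eq_sym (fc i).
  by have /forallP/(_ i) := fF (tnth c i); rewrite eqxx eq_sym.
have cardF j : #|F j| = if j \in val c then 1 else v.
  case: ifPn => [/tnthP[i ->] | jc].
    rewrite -(card1 (a i)); apply: eq_card => b; rewrite !inE.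
    apply/forallP/eqP => [/(_ i) | -> i']; first by rewrite eqxx => /eqP.
    by apply/implyP => /eqP/(tuple_uniqP _ uc) ->.
  rewrite -[RHS]card_ord; apply: eq_card => b; rewrite !inE.
  by apply/forallP => i; apply/implyP => /eqP ij; rewrite -ij mem_tnth in jc.
rewrite card_family foldrE big_map big_enum /=.
rewrite (eq_bigr _ (fun j _ => cardF j)) (bigID (mem (val c))) /=.
rewrite big1 => [|j ->//]; rewrite mul1n.
rewrite (eq_bigr (fun=> v)) => [|j /negbTE ->//].
rewrite prod_nat_const -expnD -[in RHS](card_ord k) -(cardC (mem (val c))).
by rewrite addnC (card_uniqP uc) size_tuple.
Qed.

(* A uniformly random row covers each interaction with probability [v ^- t]. *)
Lemma exists_good_row {t k v : nat} (U : {set _}) : 0 < v ->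
    U \subset interactions t k v ->
  exists f, #|[set x in U | ~~ covers f x]| * v ^ t <= #|U| * (v ^ t - 1).
Proof.
move=> v_gt0 /subsetP sU; apply/existsP; apply: contraT => /existsPn noF.
have : \sum_(f : {ffun 'I_k -> 'I_v}) #|U| * (v ^ t - 1) <
       \sum_(f : {ffun 'I_k -> 'I_v}) #|[set x in U | ~~ covers f x]| * v ^ t.
  rewrite [ltnLHS](bigD1 [ffun=> Ordinal v_gt0]) //.
  rewrite [ltnRHS](bigD1 [ffun=> Ordinal v_gt0]) //=.
  rewrite -addSn leq_add ?ltnNge ?noF //; apply: leq_sum => f _.
  by rewrite ltnW // ltnNge noF.
(* Double counting of the pairs of a row and an interaction of [U] that it misses. *)
have -> : \sum_(f : {ffun 'I_k -> 'I_v}) #|[set x in U | ~~ covers f x]| * v ^ t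
    = \sum_(x in U) #|[set f : {ffun 'I_k -> 'I_v} | ~~ covers f x]| * v ^ t.
  rewrite -!big_distrl /=; congr (_ * _).
  under eq_bigr do rewrite cardsE -sum1_card big_mkcondr /=.
  rewrite exchange_big /=; apply: eq_bigr => x _.
  by rewrite -big_mkcond /= sum1_card cardsE.
rewrite (eq_bigr (fun=> v ^ k * (v ^ t - 1))) => [|x /sU xI].
  by rewrite !sum_nat_const card_ffun !card_ord; lia.
have <- : ~: [set f | covers f x] = [set f | ~~ covers f x].
  by apply/setP => f; rewrite !inE.
have := card_covers x xI; have := cardsC [set f | covers f x].
by rewrite card_ffun !card_ord; nia.
Qed.

Lemma has_CA_rows {t k v : nat} (rs : seq {ffun 'I_k -> 'I_v}) :
  @uncovered t k v rs = set0 -> has_CA t k v (size rs).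
Proof.
move=> rs0; apply/existsP; exists (\matrix_(r, j) tnth (in_tuple rs) r j)%R.
apply/forallP => c; apply/implyP => /injectiveP c_inj; apply/forallP => a.
(* The injective choice [c] of columns is sorted, and [a'] below carries the word [a] along with the
   reordering. *)
have szc : size (sort (relpre val leq) (codom c)) == t.
  by rewrite size_sort size_codom card_ord.
pose s : t.-tuple 'I_k := Tuple szc.
have memE i : tnth s i \in codom c by rewrite -(mem_sort (relpre val leq)) mem_tnth.
pose a' : {ffun 'I_t -> 'I_v} := [ffun i => a (iinv (memE i))].
have sI : (s, a') \in interactions t k v.
  rewrite !inE andbT /= ltn_sorted_uniq_leq (map_inj_uniq val_inj) sort_uniq.
  rewrite map_inj_uniq // enum_uniq /=
    sorted_map sort_sorted // => ? ?; exact: leq_total.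
have := in_set0 (s, a'); rewrite -rs0 inE sI /= => /negbFE/hasP[f frs /forallP fc].
have /tnthP[r fE] : f \in in_tuple rs by [].
apply/existsP; exists r; apply/forallP => i; rewrite mxE -fE.
have /tnthP[i' ci] : c i \in s by rewrite mem_sort codom_f.
have := fc i'; rewrite /= -ci => /eqP ->; rewrite ffunE.
by apply/eqP; congr (a _); apply: c_inj; rewrite f_iinv ci.
Qed.

(* Two rows that differ everywhere cover disjoint sets of interactions; each
   further row is chosen greedily. *)
Lemma exists_greedy_rows (t k v n : nat) : 0 < t -> 1 < v ->
  exists2 rs : seq {ffun 'I_k -> 'I_v}, size rs = n.+2 &
    #|@uncovered t k v rs| * (v ^ t) ^ n
      <= 'C(k, t) * (v ^ t - 2) * (v ^ t - 1) ^ n.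
Proof.
move=> t_gt0 v_gt1; have v_gt0 := ltnW v_gt1.
elim: n => [|n [rs szrs IH]].
  pose b0 := Ordinal v_gt0; pose b1 := Ordinal v_gt1.
  exists [:: [ffun=> b0]; [ffun=> b1]] => //; rewrite !muln1.
  pose B : {set {ffun 'I_t -> 'I_v}} := [set [ffun=> b0]; [ffun=> b1]].
  have cardB : #|B| = 2.
    rewrite cards2; case: eqP => // /ffunP/(_ (Ordinal t_gt0)).
    by rewrite !ffunE.
  have <- : #|~: B| = v ^ t - 2.
    by rewrite cardsCs setCK cardB card_ffun !card_ord.
  rewrite -(card_ltn_sorted_tuples t k) -cardsX; apply/subset_leq_card.
  apply/subsetP => -[c a]; rewrite !inE /= andbT => /andP[-> /=].
  rewrite orbF; apply: contra => /orP[] /eqP ->; apply/orP; [left | right];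
    by apply/forallP => i; rewrite !ffunE.
have [||f fP] := @exists_good_row t k v (uncovered rs) => //.
  by apply/subsetP => x; rewrite inE => /andP[].
exists (f :: rs); first by rewrite /= szrs.
have -> : @uncovered t k v (f :: rs) = [set x in uncovered rs | ~~ covers f x].
  by apply/setP => x; rewrite !inE /= negb_or andbA -!andbA [X in _ && (_ && X)]andbC.
rewrite !expnS.
apply: (@leq_trans (#|@uncovered t k v rs| * (v ^ t - 1) * (v ^ t) ^ n)).
  by rewrite mulnA leq_mul2r fP orbT.
by rewrite mulnAC [leqRHS]mulnCA mulnC leq_mul2l IH orbT.
Qed.

Lemma CAN_le_greedy (t k v n : nat) : 0 < t -> 1 < v ->
  exists2 u, CAN t k v <= n.+2 + u &
    u * (v ^ t) ^ n <= 'C(k, t) * (v ^ t - 2) * (v ^ t - 1) ^ n.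
Proof.
move=> t_gt0 v_gt1; have v_gt0 := ltnW v_gt1.
have [rs szrs rsP] := exists_greedy_rows t k v n t_gt0 v_gt1.
exists #|@uncovered t k v rs| => //.
have [_ minCAN] := CANP t k v_gt0.
(* The default is never reached on an interaction: by [card_covers] some row covers it. *)
pose g x := odflt [ffun=> Ordinal v_gt0] [pick f | @covers t k v f x].
have gP x : x \in interactions t k v -> covers (g x) x.
  move=> /card_covers xP; rewrite /g; case: pickP => //= no.
  have S0 : [set f | covers f x] = set0 by apply/setP => f; rewrite !inE no.
  by move: xP; rewrite S0 cards0 mul0n => /esym/eqP; rewrite expn_eq0 eqn0Ngt v_gt0.
rewrite -szrs cardE -(size_map g) -size_cat; apply: minCAN; apply: has_CA_rows.
apply/setP => x; rewrite in_set0 in_set has_cat negb_or; apply/negbTE/negP.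
move=> /and3P[xI xrs /hasP]; case; exists (g x); last exact: gP.
by rewrite map_f // mem_enum in_set xI.
Qed.

Lemma CAN_le_full (k v : nat) : 0 < v -> CAN k k v <= v ^ k.
Proof.
move=> v_gt0; have [_ minCAN] := CANP k k v_gt0.
by have := minCAN _ (has_CA_full k k v_gt0); rewrite card_ffun !card_ord.
Qed.

(* Imported only here: their set notations hide those of finite sets. *)
From mathcomp Require Import all_classical all_reals all_analysis.
Import Order.TTheory GRing.Theory Num.Theory.
Local Open Scope ring_scope.

(** Follows from e^y >= (1 + y/2)^2; 3/4 is the coefficient that cancels the y^2 term in the product
    with this square. *)
Lemma expRN_le_quadratic {R : realType} (y : R) :
  0 <= y -> expR (- y) <= 1 - y + 3 / 4 * y ^+ 2.
Proof.
move=> y_ge0.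
have le_exp : (1 + y / 2) ^+ 2 <= expR y.
  rewrite [in leRHS](_ : y = 2%:R * (y / 2)); last by field.
  by rewrite expRM_natl lerXn2r ?nnegrE ?expR_ge0 ?expR_ge1Dx //; lra.
rewrite expRN -[leLHS]mul1r ler_pdivrMr ?expR_gt0 //.
have q_ge0 : 0 <= 1 - y + 3 / 4 * y ^+ 2 by nra.
apply: (le_trans _ (ler_wpM2l q_ge0 le_exp)).
have : 0 <= y ^+ 3 by exact: exprn_ge0.
have : 0 <= y ^+ 4 by exact: exprn_ge0.
have -> : (1 - y + 3 / 4 * y ^+ 2) * (1 + y / 2) ^+ 2 =
  1 + y ^+ 3 / 2 + 3 / 16 * y ^+ 4 by field.
by lra.
Qed.

(** Both bounds come from 1 + y <= e^y, taken at y = -1/V and at y = 1/(V - 1). *)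
Lemma ln_ratio_bounds {R : realType} (V : R) : 1 < V ->
  V^-1 <= ln (V / (V - 1)) <= (V - 1)^-1.
Proof.
move=> V_gt1; have ? : 0 < V by lra. have ? : 0 < V - 1 by lra.
have ? : V != 0 by lra. have ? : V - 1 != 0 by lra.
rewrite -ler_expR -[X in _ && X]ler_expR lnK ?posrE ?divr_gt0 //; apply/andP; split; last first.
  by apply: le_trans (expR_ge1Dx _); rewrite le_eqVlt; apply/orP; left; apply/eqP; field.
rewrite -[leLHS]invrK -expRN -[V / _]invrK lef_pV2 ?posrE ?expR_gt0 ?invr_gt0 ?divr_gt0 //.
by apply: le_trans (expR_ge1Dx _); rewrite le_eqVlt; apply/orP; left; apply/eqP; field; apply/andP.
Qed.

(* Here p = 1 / (V - 1) and d is the amount by which x is rounded up. *)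
Lemma rounded_stage_le {R : realType} (L p d : R) :
    0 < p -> p <= 3^-1 -> 0 < L -> L <= p ->
    0 <= d -> d <= 1 ->
  d + (1 - p ^+ 2) * (expR (- (L * d)) / L) <= L^-1.
Proof.
move=> p_gt0 p_le L_gt0 Lp d_ge0 d_le1.
have Ld_ge0 : 0 <= L * d by rewrite mulr_ge0 // ltW.
have := expRN_le_quadratic (L * d) Ld_ge0; set e := expR _ => e_le.
have s_ge0 : 0 <= 1 - p ^+ 2 by nra.
rewrite -(ler_pM2r L_gt0) mulVf ?gt_eqF // mulrDl.
rewrite mulrA mulfVK ?gt_eqF //.
apply: (@le_trans _ _ (d * L + (1 - p ^+ 2) * (1 - L * d + 3 / 4 * (L * d) ^+ 2))).
  by rewrite lerD2l ler_wpM2l.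
(* With z = L d the terms z and -z cancel: the p^2 saved by the two disjoint rows has to pay for p^2
   z and for the quadratic error. *)
suff : p ^+ 2 * (L * d) + (1 - p ^+ 2) * (3 / 4 * (L * d) ^+ 2) <= p ^+ 2 by nra.
have Ldp : L * d <= p by nra.
have : (L * d) ^+ 2 <= p ^+ 2 by nra.
set z := L * d in Ld_ge0 Ldp *; move=> z2.
have : p ^+ 2 * z <= p ^+ 2 * p by rewrite ler_wpM2l // exprn_ge0 // ltW.
have : (1 - p ^+ 2) * (3 / 4 * z ^+ 2) <= (1 - p ^+ 2) * (3 / 4 * p ^+ 2).
  by rewrite ler_wpM2l // ler_wpM2l //; lra.
(* The factor in parentheses is at most 1 because (1 - 3p)(1 - p) >= 0; this is where p <= 1/3, that
   is V >= 4, enters. *)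
suff : p ^+ 2 * (p + (1 - p ^+ 2) * (3 / 4)) <= p ^+ 2 by nra.
by rewrite ger_pMr ?exprn_gt0 //; nra.
Qed.

(** The exponential equals eta V L ((V - 1)/V)^(n+2), and 1 - p^2 = V (V - 2)/(V - 1)^2, so the
    bound is exactly eta (V - 2) ((V - 1)/V)^n. *)
Lemma greedy_remainder_le {R : realType} (V eta x u : R) (n : nat) :
  let L := ln (V / (V - 1)) in
  let p := (V - 1)^-1 in
  2 < V -> 0 < eta -> expR (x * L) = eta * V * L ->
  u * V ^+ n <= eta * (V - 2) * (V - 1) ^+ n ->
  u <= (1 - p ^+ 2) * (expR (- (L * (n.+2%:R - x))) / L).
Proof.
move=> L p V_gt2 eta_gt0 expx uP.
have ? : 0 < V by lra. have ? : 0 < V - 1 by lra.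
have ? : V != 0 by lra. have ? : V - 1 != 0 by lra.
have eta0 : eta != 0 by rewrite gt_eqF.
have L_gt0 : 0 < L.
  have /andP[lL _] := ln_ratio_bounds V ltac:(lra).
  by apply: lt_le_trans lL; rewrite invr_gt0.
have L0 : L != 0 by rewrite gt_eqF.
have expL : expR L = V / (V - 1) by rewrite lnK // posrE divr_gt0.
have -> : - (L * (n.+2%:R - x)) = x * L + - (n.+2%:R * L) by ring.
rewrite expRD expx expRN expRM_natl expL -exprVn invf_div.
rewrite -(ler_pM2r (exprn_gt0 n (_ : 0 < V))) //; apply: (le_trans uP).
rewrite expr_div_n !exprSr /p le_eqVlt; apply/orP; left; apply/eqP.
have Vn0 : V ^+ n != 0 by rewrite expf_neq0.
by field; rewrite Vn0 L0; do ?[apply/andP; split].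
Qed.

Theorem theorem5 (R : realType) (t k v : nat)
    (ht : (2 <= t)%N) (hkt : (t <= k)%N) (hv : (2 <= v)%N) :
  let eta : R := 'C(k, t)%:R in
  let rho : R := 'C(k, t)%:R - 'C(k - t, t)%:R in
  let V : R := v%:R ^+ t in
  let L : R := ln (V / (V - 1)) in
  eta * V * L / rho <= V ->
  (CAN t k v)%:R <=
    (ln ('C(k, t)%:R) + t%:R * ln (v%:R) + ln L + 2) / L - eta / rho.
Proof.
move=> eta rho V L hyp.
have v_gt0 : (0 < v)%N by exact: ltnW hv.
have VN : V = (v ^ t)%N%:R by rewrite natrX.
have VN4 : (4 <= v ^ t)%N.
  by rewrite (@leq_trans (2 ^ t)) ?leq_exp2r ?(@leq_pexp2l 2 2) // ltnW.
have V_ge4 : 4 <= V by rewrite VN (ler_nat R 4).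
have V_gt0 : 0 < V by lra.
have /andP[lL uL] := ln_ratio_bounds V ltac:(lra).
have L_gt0 : 0 < L by apply: lt_le_trans lL; rewrite invr_gt0.
have L0 : L != 0 by rewrite gt_eqF.
have VL_ge1 : 1 <= V * L by rewrite mulrC -ler_pdivrMr // div1r.
have eta_ge1 : 1 <= eta by rewrite (ler_nat R 1) bin_gt0.
have eta_gt0 : 0 < eta by lra.
pose x := (ln eta + t%:R * ln v%:R + ln L) / L.
have expx : expR (x * L) = eta * V * L.
  by rewrite mulfVK // !expRD expRM_natl !lnK ?posrE ?ltr0n ?bin_gt0 //.
have x_ge0 : 0 <= x.
  rewrite -(pmulr_lge0 _ L_gt0) -ler_expR expR0 expx -mulrA; nra.
have -> : (ln 'C(k, t)%:R + t%:R * ln v%:R + ln L + 2) / L - eta / rho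
    = x + 2 / L - eta / rho by rewrite mulrDl.
(* For k = t, ['C(0, t) = 0] gives eta / rho = 1, and x + 2/L - 1 >= 2 (V - 1) - 1 >= V. *)
have [tk | kt] := eqVneq t k.
  have -> : eta / rho = 1.
    by rewrite /eta /rho tk binn subnn bin_small ?subr0 ?divr1 // -tk ltnW.
  have : (CAN t k v)%:R <= V by rewrite VN ler_nat -tk CAN_le_full.
  have : V - 1 <= L^-1.
    by rewrite -[leLHS]invrK lef_pV2 ?posrE ?invr_gt0 //; lra.
  by lra.
have eta_rho : eta / rho <= L^-1.
  rewrite -(ler_pM2r L_gt0) mulVf // -(ler_pM2l V_gt0) mulr1.
  by apply: le_trans hyp; rewrite le_eqVlt; apply/orP; left; apply/eqP; ring.
have eta_ge2 : 2 <= eta.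
  rewrite (ler_nat R 2) (@leq_trans 'C(t.+1, t)) ?leq_bin2l //.
    by rewrite binSn ltnW.
  by rewrite ltn_neqAle kt.
(* Rounding x up must leave room for the two initial rows; here e^L <= 4/3 < 2 <= eta V L. *)
have x_gt1 : 1 < x.
  rewrite -(ltr_pM2r L_gt0) mul1r -ltr_expR expx lnK ?posrE ?divr_gt0 //; try lra.
  have : 2 * 1 <= eta * (V * L) by rewrite ler_pM.
  by rewrite mulrA ltr_pdivrMr; [nra | lra].
(* As n + 2 = floor(x) + 1, the excess d = n + 2 - x satisfies 0 < d <= 1. *)
have [n nP] : exists n, (Num.truncn x).+1 = n.+2.
  have : (1 <= Num.truncn x)%N by rewrite truncn_ge_nat // ltW.
  by case: (Num.truncn x) => // n _; exists n.
have /andP[xl xu] := truncn_itv x_ge0; rewrite nP in xu.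
have d_le1 : n.+2%:R - x <= 1 by rewrite -nP -natr1; lra.
have [u CANu uP] := CAN_le_greedy t k v n (ltnW ht) hv.
have {}CANu : (CAN t k v)%:R <= n.+2%:R + u%:R :> R by rewrite -natrD ler_nat.
have {}uP : u%:R * V ^+ n <= eta * (V - 2) * (V - 1) ^+ n.
  have V1 : V - 1 = (v ^ t - 1)%N%:R.
    by rewrite natrB -?VN // (leq_trans _ VN4).
  have V2 : V - 2 = (v ^ t - 2)%N%:R.
    by rewrite natrB -?VN // (leq_trans _ VN4).
  by rewrite V1 V2 VN -!natrX -!natrM ler_nat.
have uR := greedy_remainder_le V eta x u%:R n ltac:(lra) eta_gt0 expx uP.
have p_le : (V - 1)^-1 <= 3^-1 by rewrite lef_pV2 ?posrE //; lra.
have p_gt0 : 0 < (V - 1)^-1 by rewrite invr_gt0; lra.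
have := rounded_stage_le L _ (n.+2%:R - x) p_gt0 p_le L_gt0 uL ltac:(lra) d_le1.
by rewrite -/L in uR *; lra.
Qed.
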